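(* Let $p$ be an odd prime, let $G$ be the abelian group of order $p^2$ and exponent $p$, and let $\mathsf{S}$ be a supercharacter theory of $G$. Assume that $[G,\mathsf{S}]<G$ or $Z(\mathsf{S})>1$. Then one of the following holds: (1) $\mathsf{S}$ is a $\ast$-product over $[G,\mathsf{S}]$; (2) $\mathsf{S}$ is a $\ast$-product over $Z(\mathsf{S})$; (3) $\mathsf{S}$ is a direct product over $[G,\mathsf{S}]$ and $Z(\mathsf{S})$. In particular, $\mathsf{S}$ comes from automorphisms.
   Context: A supercharacter theory of a finite group $G$ is a pair $\mathsf{S}=(\mathcal{X},\mathcal{K})$, where $\mathcal{X}$ is a partition of $\mathrm{Irr}(G)$ and $\mathcal{K}$ is a partition of $G$, such that $|\mathcal{X}|=|\mathcal{K}|$, $\{1\}\in\mathcal{K}$, and for every $X\in\mathcal{X}$ there is a (nonzero) character $\xi_X$ whose irreducible constituents lie in $X$ and which is constant on each part of $\mathcal{K}$. The parts of $\mathcal{K}$ are the $\mathsf{S}$-classes (superclasses), $\mathrm{Cl}(\mathsf{S})=\mathcal{K}$, and $\mathrm{cl}_{\mathsf{S}}(g)$ is the $\mathsf{S}$-class containing $g$. A supercharacter theory is uniquely determined by its superclasses. A subgroup $N$ is $\mathsf{S}$-normal if it is a union of $\mathsf{S}$-classes. In that case $\mathsf{S}_N$ denotes the supercharacter theory of $N$ whose classes are the $\mathsf{S}$-classes contained in $N$, and $\mathsf{S}_{G/N}$ denotes the supercharacter theory of $G/N$ whose classes are the images of the $\mathsf{S}$-classes under $G\to G/N$. $Z(\mathsf{S})=\{z\in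 G:|\mathrm{cl}_{\mathsf{S}}(z)|=1\}$ and $[G,\mathsf{S}]=\langle g^{-1}k: g\in G,\ k\in\mathrm{cl}_{\mathsf{S}}(g)\rangle$; both are $\mathsf{S}$-normal subgroups. For $G$ abelian, $N\le G$, $\mathsf{U}$ a supercharacter theory of $N$ and $\mathsf{V}$ a supercharacter theory of $G/N$, the $\ast$-product $\mathsf{U}\ast\mathsf{V}$ is the supercharacter theory of $G$ whose superclasses are the $\mathsf{U}$-classes together with the full preimages in $G$ of the nonidentity $\mathsf{V}$-classes. $\mathsf{S}$ is a $\ast$-product over the $\mathsf{S}$-normal subgroup $N$ if $\mathsf{S}=\mathsf{S}_N\ast\mathsf{S}_{G/N}$ (equivalently, every $\mathsf{S}$-class outside $N$ is a union of $N$-cosets). If $G=H\times K$, the direct product $\mathsf{E}\times\mathsf{F}$ of supercharacter theories $\mathsf{E}$ of $H$ and $\mathsf{F}$ of $K$ is the supercharacter theory of $G$ with superclasses $A\times B$, $A\in\mathrm{Cl}(\mathsf{E})$, $B\in\mathrm{Cl}(\mathsf{F})$. $\mathsf{S}$ is a direct product over $H$ and $K$ if $H,K$ are $\mathsf{S}$-normal, $G=H\times K$ and $\mathsf{S}=\mathsf{S}_H\times\mathsf{S}_K$. $\mathsf{S}$ comes from automorphisms if there is $A\le\mathrm{Aut}(G)$ such that the $\mathsf{S}$-classes are exactly the $A$-orbits on $G$. *)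

(* Defs.v *)
From HB Require Import structures.
From mathcomp Require Import all_boot all_order all_algebra all_fingroup.
From mathcomp Require Import all_solvable all_field all_character.

Set Implicit Arguments.
Unset Strict Implicit.
Unset Printing Implicit Defensive.

Import GroupScope GRing.Theory.

(* Irr(G) is represented by its index type Iirr G, with 'chi_i the i-th        *)
(* irreducible character.                                                      *)
Record superTheory (gT : finGroupType) (G : {group gT}) := SuperTheory {
  superCharParts : {set {set Iirr G}};
  superClasses : {set {set gT}};
  superCharParts_partition : partition superCharParts [set: Iirr G];
  superClasses_partition : partition superClasses G;
  card_superParts : #|superCharParts| = #|superClasses|;
  superClass1 : [set 1] \in superClasses;
  superCharP : forall X : {set Iirr G}, X \in superCharParts ->
    exists xi : 'CF(G),
      [/\ xi \is a character,
          xi != 0%R,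
          forall i : Iirr G, i \in irr_constt xi -> i \in X
        & forall (A : {set gT}) (x y : gT),
            A \in superClasses -> x \in A -> y \in A -> xi x = xi y]
}.

Section SuperTheory.

Variables (gT : finGroupType) (G : {group gT}) (S : superTheory G).
Implicit Types (N H K : {set gT}).

Definition superClass (g : gT) : {set gT} := pblock (superClasses S) g.

Definition superCenter : {set gT} := [set z in G | #|superClass z| == 1%N].

Definition superComm : {set gT} :=
  <<[set g^-1 * k | g in G, k in superClass g]>>.

(* N is a plain set so that the notion applies to superCenter, whose closure   *)
(* under multiplication is then part of what superNormal asserts.              *)
Definition superNormal N : Prop :=
  group_set N /\
  exists P : {set {set gT}}, P \subset superClasses S /\ cover P = N.

(* A supercharacter theory is determined by its superclasses, so S_N, S_{G/N}, *)
(* products and equality of theories are all expressed on superclasses.        *)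
Definition subSuperClasses N : {set {set gT}} :=
  [set A in superClasses S | A \subset N].

Definition quoSuperClasses N : {set {set coset_of N}} :=
  [set A / N | A in superClasses S].

Definition starClasses N (U : {set {set gT}}) (V : {set {set coset_of N}}) :
    {set {set gT}} :=
  U :|: [set coset N @*^-1 B | B in V & B != [set 1]].

Definition starProductOver N : Prop :=
  superNormal N /\
  superClasses S = starClasses (subSuperClasses N) (quoSuperClasses N).

(* For G = H \x K internally, the class A x B is the product set A * B.        *)
Definition dprodClasses (U V : {set {set gT}}) : {set {set gT}} :=
  [set A * B | A in U, B in V].

Definition directProductOver H K : Prop :=
  [/\ superNormal H, superNormal K, H \x K = G
    & superClasses S = dprodClasses (subSuperClasses H) (subSuperClasses K)].

Definition comesFromAutomorphisms : Prop :=
  exists A : {group {perm gT}},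
    A \subset Aut G /\ superClasses S = [set orbit 'P A g | g in G].

End SuperTheory.

(* Main.v *)
Require Import Defs.
From HB Require Import structures.
From mathcomp Require Import all_boot all_order all_algebra all_fingroup.
From mathcomp Require Import all_solvable all_field all_character.

Set Implicit Arguments.
Unset Strict Implicit.
Unset Printing Implicit Defensive.

Import GroupScope.
Import GRing.Theory Num.Theory.

(** Write x ~ y when x and y lie in one superclass, C for [G, S] and Z for Z(S),
    and assume first only that G is abelian.  Everything rests on one duality:
    a function on G is constant on the superclasses if and only if its Fourier
    coefficients are constant on the parts of Irr(G) ([superFunP]).  Hence the
    superclasses are separated by the sums of the characters in a part, and the
    parts by the sums of character values over a superclass.  Three consequences
    follow for G, together with their mirror images for Irr(G):
    - x ~ y implies x^k ~ y^k for k prime to |G|, by applying a Galois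
      automorphism to the separating sums;
    - Z is a subgroup and translation by Z preserves ~, because the elements of Z
      are those at which each character of a part takes the same value; dually,
      the characters that are constant on the superclasses are those trivial on
      C, and multiplication by them permutes the parts;
    - the superclass of z in Z is {z}; dually, the part of a character trivial on
      C is a singleton.

    Now let G be elementary abelian of order p^2.  The three properties alone
    give a dichotomy ([coset_dichotomy]), stated for any relation with these
    symmetries with respect to a subgroup W of order p: either the classes
    outside W are unions of W-cosets, or there is g outside W such that x ~ y
    implies that x^-1 y lies in <g>.  Indeed, if some class is not a union of
    cosets, then it meets each coset of W at most once.  If it contains x0 and
    x0^m w with m not 1 modulo p, the equation u^(m-1) = w has a solution u in W,
    and then x0 u ~ (x0 u)^m; this turns out to confine the class of g = x0 u
    to <g>.

    If Z has order p, the dichotomy for W = Z gives either that S is a *-product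
    over Z, or that C = <g> is a complement of Z; in the latter case translation
    by Z makes S the direct product over C and Z.  If Z = 1, then C is a proper
    nontrivial subgroup, and the dichotomy is applied in the dual group to the
    group W of characters trivial on C.  Its second alternative would force the
    kernel of g, which is not trivial since G is not cyclic, into Z
    ([superComm_cosets_or_center]).  So parts outside W are unions of W-cosets,
    which means that the superclasses outside C are unions of C-cosets: S is a
    *-product over C.

    Finally, S comes from the group of all automorphisms a with a(x) ~ x for all
    x.  To see that it is transitive on the superclass of x, take y ~ x and
    choose d such that (x, d) and (y, d) are both bases of G and
    x^i d^j ~ y^i d^j for all i and j; the automorphism replacing x by y in the
    basis does the job ([comesFromAutomorphisms_basis]). *)

(** * Fourier duality between superclasses and parts of characters *)

Section Duality.

Variables (gT : finGroupType) (G : {group gT}) (S : superTheory G).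
Hypothesis abelG : abelian G.

Definition charPart (i : Iirr G) : {set Iirr G} := pblock (superCharParts S) i.

Definition superFun (f : 'CF(G)) : Prop :=
  {in G &, forall x y, superClass S x = superClass S y -> f x = f y}.

Lemma mem_superClass x : x \in G -> x \in superClass S x.
Proof. by rewrite mem_pblock (cover_partition (superClasses_partition S)). Qed.

Lemma superClass_in x : x \in G -> superClass S x \in superClasses S.
Proof.
by move=> Gx; rewrite pblock_mem // (cover_partition (superClasses_partition S)).
Qed.

Lemma superClass_def (A : {set gT}) x :
  A \in superClasses S -> x \in A -> superClass S x = A.
Proof. by apply: def_pblock; case/and3P: (superClasses_partition S). Qed.

Lemma superClass_sub A : A \in superClasses S -> A \subset G.
Proof.
by move=> SA; rewrite -(cover_partition (superClasses_partition S)) bigcup_sup.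
Qed.

Lemma superClass_neq0 A : A \in superClasses S -> exists x, x \in A.
Proof.
move=> SA; apply/set0Pn; apply: contraTneq SA => ->.
by case/and3P: (superClasses_partition S).
Qed.

Lemma superClass_eq x y : x \in G -> y \in superClass S x ->
  superClass S y = superClass S x.
Proof. by move=> Gx; apply: superClass_def; apply: superClass_in. Qed.

Lemma superClass_id1 : superClass S 1 = [set 1].
Proof. by apply: superClass_def; rewrite ?set11 // superClass1. Qed.

Lemma mem_charPart i : i \in charPart i.
Proof.
by rewrite mem_pblock (cover_partition (superCharParts_partition S)) inE.
Qed.

Lemma charPart_in i : charPart i \in superCharParts S.
Proof.
by rewrite pblock_mem // (cover_partition (superCharParts_partition S)) inE.
Qed.

Lemma charPart_def X i : X \in superCharParts S -> i \in X -> charPart i = X.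
Proof. by apply: def_pblock; case/and3P: (superCharParts_partition S). Qed.

Lemma charPart_neq0 X : X \in superCharParts S -> exists i, i \in X.
Proof.
move=> SX; apply/set0Pn; apply: contraTneq SX => ->.
by case/and3P: (superCharParts_partition S).
Qed.

Lemma cfun_indicatorE (A : {set gT}) x : A \subset G -> ('1_A : 'CF(G))%R x = (x \in A)%:R%R.
Proof. by rewrite (sub_abelian_normal _ abelG) => /cfuniE. Qed.

Lemma superFun_sum_indicator f : superFun f ->
  f = (\sum_(A in superClasses S) f (repr A) *: '1_A)%R.
Proof.
move=> Sf; apply/cfun_inP=> x Gx; rewrite sum_cfunE.
rewrite (bigD1 (superClass S x)) ?superClass_in //= big1 => [|A /andP[SA neqA]].
  rewrite addr0 cfunE cfun_indicatorE ?superClass_sub ?superClass_in //.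
  rewrite mem_superClass // mulr1.
  have Cr : repr (superClass S x) \in superClass S x.
    by apply: mem_repr (mem_superClass Gx).
  apply: Sf => //; last by rewrite (superClass_eq Gx Cr).
  by apply: subsetP Cr; rewrite superClass_sub ?superClass_in.
rewrite cfunE cfun_indicatorE ?superClass_sub //.
case: (boolP (x \in A)) => [Ax | _]; last by rewrite mulr0.
by rewrite (superClass_def SA Ax) eqxx in neqA.
Qed.

(** The given characters are orthogonal because their constituents lie in
    different parts.  There are as many of them as there are superclasses, which
    is the dimension of the space of functions constant on the superclasses, so
    they form a basis of that space. *)
Lemma superFun_expansion : exists2 xi : {set Iirr G} -> 'CF(G),
    {in superCharParts S, forall X, superFun (xi X)
       /\ forall i, i \in irr_constt (xi X) -> i \in X}
  & forall f, superFun f -> exists c : {set Iirr G} -> algC,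
      f = (\sum_(X in superCharParts S) c X *: xi X)%R.
Proof.
have /fin_all_exists[xi xiP] (X : {set Iirr G}) : exists xi : 'CF(G),
    X \in superCharParts S ->
    [/\ xi != 0%R, superFun xi & forall i, i \in irr_constt xi -> i \in X].
  have [SX | _] := boolP (X \in superCharParts S); last by exists 0%R.
  have [xi [_ nz_xi xiX xiK]] := superCharP SX.
  exists xi => _; split=> // x y Gx Gy eqxy.
  by apply: (xiK _ x y (superClass_in Gx)); rewrite ?mem_superClass // eqxy
    mem_superClass.
pose P := enum (superCharParts S).
have PP X : (X \in P) = (X \in superCharParts S) by rewrite mem_enum.
have orth X Y : X \in superCharParts S -> Y \in superCharParts S -> X != Y ->
    ('[xi X, xi Y] = 0)%R.
  move=> SX SY neqXY; rewrite cfdot_sum_irr big1 // => i _.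
  have [Xi | ] := boolP (i \in irr_constt (xi X)); last first.
    by rewrite irr_consttE negbK => /eqP ->; rewrite mul0r.
  have [Yi | ] := boolP (i \in irr_constt (xi Y)); last first.
    by rewrite irr_consttE negbK => /eqP ->; rewrite conjC0 mulr0.
  case/eqP: neqXY; have [_ _ cX] := xiP X SX; have [_ _ cY] := xiP Y SY.
  by rewrite -(charPart_def SX (cX i Xi)) (charPart_def SY (cY i Yi)).
pose xs := [seq xi X | X <- P].
have xi_inj : {in P &, injective xi}.
  move=> X Y; rewrite !PP => SX SY eqXY; apply/eqP; apply: contraT => neqXY.
  have [/eqP[]] := xiP X SX; apply/eqP; rewrite -cfnorm_eq0.
  by rewrite {2}eqXY orth.
have orth_xs : pairwise_orthogonal xs.
  apply/pairwise_orthogonalP; split.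
    rewrite cons_uniq map_inj_in_uniq ?enum_uniq // andbT.
    apply/mapP=> -[X]; rewrite PP => SX eq0.
    by have [/eqP[]] := xiP X SX.
  move=> _ _ /mapP[X XP ->] /mapP[Y YP ->]; rewrite PP in XP.
  rewrite PP in YP => neqXY; apply: orth => //.
  by apply: contraNneq neqXY => ->.
pose ws := [seq '1_A : 'CF(G) | A <- enum (superClasses S)]%R.
have in_ws f : superFun f -> f \in <<ws>>%VS.
  move=> Sf; rewrite (superFun_sum_indicator Sf); apply: memv_suml => A SA.
  by apply/memvZ/memv_span/map_f; rewrite mem_enum.
have eq_span : <<xs>>%VS = <<ws>>%VS.
  apply/eqP; rewrite eqEdim; apply/andP; split.
    apply/span_subvP=> _ /mapP[X XP ->]; apply: in_ws.
    by rewrite PP in XP; have [] := xiP X XP.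
  have /eqP-> := orthogonal_free orth_xs.
  apply: leq_trans (dim_span _) _.
  by rewrite !size_map -!cardE card_superParts.
exists xi => [X SX | f Sf]; first by have [] := xiP X SX.
have := in_ws f Sf; rewrite -eq_span => /(orthogonal_span orth_xs)[z _ ->].
by exists (fun X => z (xi X)); rewrite big_map big_enum.
Qed.

Lemma abelian_irr1 (i : Iirr G) : ('chi_i)%R 1 = 1%R.
Proof. by apply: lin_char1; apply: (char_abelianP G abelG). Qed.

Lemma abelian_cfReg : cfReg G = (\sum_i 'chi_i)%R.
Proof.
by rewrite cfReg_sum; apply: eq_bigr => i _; rewrite abelian_irr1 scale1r.
Qed.

Lemma cfReg_superFun : superFun (cfReg G).
Proof.
move=> x y Gx Gy eqxy; rewrite !cfRegE.
suffices ->: (x == 1) = (y == 1) by [].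
apply/eqP/eqP=> [x1 | y1].
  have := mem_superClass Gy; rewrite -eqxy x1 superClass_id1 => /set1P.
  by [].
by have := mem_superClass Gx; rewrite eqxy y1 superClass_id1 => /set1P.
Qed.

Definition charPartSum (X : {set Iirr G}) : 'CF(G) := (\sum_(i in X) 'chi_i)%R.

Lemma eq_cfun_cfdot (f g : 'CF(G)) :
  (forall i, '[f, 'chi_i] = '[g, 'chi_i])%R -> f = g.
Proof.
move=> eqfg; rewrite (cfun_sum_cfdot f) (cfun_sum_cfdot g).
by apply: eq_bigr => i _; rewrite eqfg.
Qed.

Lemma superFun_lincomb (c : {set Iirr G} -> algC) (F : {set Iirr G} -> 'CF(G)) :
    {in superCharParts S, forall X, superFun (F X)} ->
  superFun (\sum_(X in superCharParts S) c X *: F X)%R.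
Proof.
move=> SF x y Gx Gy eqxy; rewrite !sum_cfunE.
by apply: eq_bigr => X SX; rewrite !cfunE (SF X SX x y).
Qed.

(** The given character of a part is unknown, but the regular character is
    constant on the superclasses since {1} is one of them.  As all its Fourier
    coefficients are 1, expanding it in the given characters shows that each of
    these is proportional to the sum of the characters of its part. *)
Theorem superFunP f : superFun f <->
  forall i j, charPart i = charPart j -> ('[f, 'chi_i] = '[f, 'chi_j])%R.
Proof.
have [xi xiP expand] := superFun_expansion.
have coef (c : {set Iirr G} -> algC) i :
    ('[\sum_(X in superCharParts S) c X *: xi X, 'chi_i]
       = c (charPart i) * '[xi (charPart i), 'chi_i])%R.
  rewrite cfdot_suml (bigD1 (charPart i)) ?charPart_in //= cfdotZl.
  rewrite big1 ?addr0 // => X /andP[SX neqX]; rewrite cfdotZl.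
  have [Xi | ] := boolP (i \in irr_constt (xi X)).
    have [_ /(_ i Xi)/(charPart_def SX) eqX] := xiP X SX.
    by rewrite eqX eqxx in neqX.
  by rewrite irr_consttE negbK => /eqP->; rewrite mulr0.
(* The coefficient r X turns xi X into the sum of the characters in X. *)
have [r regE] := expand _ cfReg_superFun.
have regP i : (r (charPart i) * '[xi (charPart i), 'chi_i] = 1)%R.
  rewrite -coef -regE abelian_cfReg cfdot_suml (bigD1 i) //= cfdot_irr eqxx.
  rewrite big1 ?addr0 // => j /negPf neqji.
  by rewrite cfdot_irr neqji.
split=> [Sf i j eqij | coef_f].
  have [c ->] := expand f Sf; rewrite !coef eqij; congr (_ * _)%R.
  have nz_r : (r (charPart j) != 0)%R.
    by apply/eqP=> r0; have /eqP := regP j; rewrite r0 mul0r eq_sym oner_eq0.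
  by apply: (mulfI nz_r); rewrite regP -eqij regP.
suffices ->: f = (\sum_(X in superCharParts S)
    ('[f, 'chi_(odflt ord0 [pick i in X])] * r X) *: xi X)%R.
  by apply: superFun_lincomb => X SX; have [] := xiP X SX.
apply: eq_cfun_cfdot => i; rewrite coef -mulrA regP mulr1.
apply: coef_f; case: pickP => [j /= Xj | /(_ i)]; last by rewrite mem_charPart.
by rewrite (charPart_def (charPart_in i) Xj).
Qed.

Lemma cfdot_charPartSum (X : {set Iirr G}) j :
  ('[charPartSum X, 'chi_j] = (j \in X)%:R)%R.
Proof.
rewrite cfdot_suml; case: (boolP (j \in X)) => [Xj | nXj].
  rewrite (bigD1 j) //= cfdot_irr eqxx big1 ?addr0 //.
  by move=> i /andP[_ /negPf nij]; rewrite cfdot_irr nij.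
rewrite big1 // => i Xi; rewrite cfdot_irr.
by case: eqP => // ij; rewrite -ij Xi in nXj.
Qed.

Lemma charPartSum_superFun (X : {set Iirr G}) :
  X \in superCharParts S -> superFun (charPartSum X).
Proof.
move=> SX; apply/superFunP=> i j eqij; rewrite !cfdot_charPartSum.
suffices ->: (i \in X) = (j \in X) by [].
apply/idP/idP=> [Xi | Xj].
  by rewrite -(charPart_def SX Xi) eqij mem_charPart.
by rewrite -(charPart_def SX Xj) -eqij mem_charPart.
Qed.

Lemma superFun_sum_charPartSum f : superFun f -> exists c : {set Iirr G} -> algC,
  f = (\sum_(X in superCharParts S) c X *: charPartSum X)%R.
Proof.
move=> /superFunP Sf.
(* Parts are nonempty, so the default index ord0 is never reached. *)
exists (fun X : {set Iirr G} => '[f, 'chi_(odflt ord0 [pick i in X])]%R).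
apply: eq_cfun_cfdot => j; rewrite cfdot_suml (bigD1 (charPart j)) ?charPart_in //=.
rewrite cfdotZl cfdot_charPartSum mem_charPart mulr1 big1 ?addr0.
  apply: Sf; case: pickP => [i /= Xi | /(_ j)]; last by rewrite mem_charPart.
  by rewrite (charPart_def (charPart_in j) Xi).
move=> X /andP[SX neqX]; rewrite cfdotZl cfdot_charPartSum.
case: (boolP (j \in X)) => [Xj | _]; last by rewrite mulr0.
by rewrite (charPart_def SX Xj) eqxx in neqX.
Qed.

Lemma indicator_superFun (A : {set gT}) : A \in superClasses S -> superFun ('1_A)%R.
Proof.
move=> SA x y Gx Gy eqxy; rewrite !cfun_indicatorE ?superClass_sub //.
suffices ->: (x \in A) = (y \in A) by [].
apply/idP/idP=> [Ax | Ay].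
  by rewrite -(superClass_def SA Ax) eqxy mem_superClass.
by rewrite -(superClass_def SA Ay) -eqxy mem_superClass.
Qed.

(** The indicator function of the superclass of x is a combination of the sums
    on the right, so these sums already separate the superclasses. *)
Lemma eq_superClassP x y : x \in G -> y \in G ->
  superClass S x = superClass S y <->
  {in superCharParts S, forall X, charPartSum X x = charPartSum X y}.
Proof.
move=> Gx Gy; split=> [eqxy X SX | eqxy]; first exact: (charPartSum_superFun SX).
have SA := superClass_in Gx; have sAG := superClass_sub SA.
have [c def1] := superFun_sum_charPartSum (indicator_superFun SA).
have: ('1_(superClass S x) : 'CF(G))%R x = ('1_(superClass S x) : 'CF(G))%R y.
  rewrite def1 !sum_cfunE; apply: eq_bigr => X SX.
  by rewrite cfunE [in RHS]cfunE eqxy.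
rewrite !cfun_indicatorE // mem_superClass //.
case: (boolP (y \in _)) => [xy _ | _ /eqP]; last by rewrite oner_eq0.
by rewrite (superClass_eq Gx xy).
Qed.

Definition classSum (A : {set gT}) (f : 'CF(G)) : algC := (\sum_(a in A) f a)%R.

Lemma cfdot_indicator (A : {set gT}) f : A \subset G ->
  ('[f, '1_A] = #|G|%:R^-1 * classSum A f)%R.
Proof.
move=> sAG; rewrite (cfdotEr _ (cfuni_on G A)); congr (_ * _)%R.
by apply: eq_bigr => x Ax; rewrite cfun_indicatorE // Ax conjC1 mulr1.
Qed.

(** Mirror image of [eq_superClassP]: up to a scalar and complex conjugation, the
    sum of a character over a superclass is its scalar product with the
    indicator function of that superclass. *)
Lemma eq_charPartP i j : charPart i = charPart j <->
  {in superClasses S, forall A, classSum A ('chi_i)%R = classSum A ('chi_j)%R}.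
Proof.
have coef A k : A \in superClasses S ->
    (classSum A 'chi_k = #|G|%:R * ('[('1_A)%R, 'chi_k])^*)%R.
  move=> SA; rewrite -cfdotC cfdot_indicator ?superClass_sub //.
  by rewrite mulrA mulfV ?mul1r // neq0CG.
split=> [eqij A SA | eqij].
  by rewrite !coef // ((superFunP _).1 (indicator_superFun SA) _ _ eqij).
have: ('[charPartSum (charPart i), 'chi_i] = '[charPartSum (charPart i), 'chi_j])%R.
  rewrite (superFun_sum_indicator (charPartSum_superFun (charPart_in i))).
  rewrite !cfdot_suml; apply: eq_bigr => A SA; rewrite !cfdotZl; congr (_ * _)%R.
  apply: (can_inj conjCK); apply: (mulfI (neq0CG G)).
  by rewrite -!coef ?eqij.
rewrite !cfdot_charPartSum mem_charPart.
case: (boolP (j \in _)) => [Xj _ | _ /eqP]; last by rewrite oner_eq0.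
by rewrite (charPart_def (charPart_in i) Xj).
Qed.

(** * Power maps, translations, [Z(S)] and [[G, S]] *)

Lemma irr_lin (i : Iirr G) : ('chi_i)%R \is a linear_char.
Proof. exact: char_abelianP. Qed.

(** Raising to the k-th power is not additive, but on the roots of unity that
    occur as character values it is the restriction of a field automorphism,
    which commutes with the sums separating superclasses and parts. *)
Lemma Galois_power k : coprime k #|G| ->
  exists u : {rmorphism algC -> algC},
  forall (i : Iirr G) x, x \in G -> (u ('chi_i x) = 'chi_i x ^+ k)%R.
Proof.
move=> cokG; have [u uE] := Qn_aut_exists cokG; exists u => i x Gx.
by apply: uE; rewrite -lin_charX ?irr_lin // expg_cardG // lin_char1 ?irr_lin.
Qed.

Lemma superClassX k x y : coprime k #|G| -> x \in G -> y \in G ->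
  superClass S x = superClass S y -> superClass S (x ^+ k) = superClass S (y ^+ k).
Proof.
move=> /Galois_power[u uE] Gx Gy /(eq_superClassP Gx Gy) eqxy.
have sumX X z : z \in G -> charPartSum X (z ^+ k) = u (charPartSum X z).
  move=> Gz; rewrite !sum_cfunE rmorph_sum; apply: eq_bigr => i _.
  by rewrite uE // lin_charX ?irr_lin.
by apply/eq_superClassP=> [||X SX]; rewrite ?groupX // !sumX ?eqxy.
Qed.

Lemma charPartX k i j i' j' : coprime k #|G| ->
    ('chi_i' = 'chi_i ^+ k)%R -> ('chi_j' = 'chi_j ^+ k)%R ->
  charPart i = charPart j -> charPart i' = charPart j'.
Proof.
move=> /Galois_power[u uE] chi_i' chi_j' /eq_charPartP eqij.
have sumX A h h' : A \in superClasses S -> ('chi_h' = 'chi_h ^+ k)%R ->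
    (classSum A ('chi_h') = u (classSum A ('chi_h)))%R.
  move=> SA chi_h'; rewrite rmorph_sum; apply: eq_bigr => a Aa.
  have Ga : a \in G by apply: subsetP Aa; apply: superClass_sub.
  by rewrite uE // chi_h' exp_cfunE.
by apply/eq_charPartP=> A SA; rewrite (sumX A i i') // (sumX A j j') // eqij.
Qed.

Lemma superCenter_class1 z : z \in superCenter S -> superClass S z = [set z].
Proof.
rewrite inE => /andP[Gz /cards1P[t clz]]; have := mem_superClass Gz.
by rewrite clz => /set1P->.
Qed.

(** The Fourier coefficients of the indicator function of {z} are the conjugates
    of the values at z, up to a scalar; by duality {z} is a superclass when they
    are constant on the parts. *)
Lemma superCenterP z : reflect
    (z \in G /\ forall i j, charPart i = charPart j -> ('chi_i z = 'chi_j z)%R)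
  (z \in superCenter S).
Proof.
apply: (iffP idP) => [Zz | [Gz eqz]].
  have Gz : z \in G by move: Zz; rewrite inE => /andP[].
  have clz := superCenter_class1 Zz; split=> // i j /eq_charPartP/(_ [set z]).
  by rewrite -clz superClass_in // clz /classSum !big_set1; apply.
rewrite inE Gz /=.
have sz : [set z] \subset G by rewrite sub1set.
apply/cards1P; exists z; apply/eqP; rewrite eqEsubset sub1set mem_superClass //.
rewrite andbT; apply/subsetP=> y zy; rewrite inE.
have Gy : y \in G by apply: subsetP zy; rewrite superClass_sub ?superClass_in.
have: ('1_[set z] : 'CF(G))%R y = ('1_[set z] : 'CF(G))%R z.
  have /superFunP : forall i j, charPart i = charPart j ->
      ('[('1_[set z])%R : 'CF(G), 'chi_i] = '[('1_[set z])%R, 'chi_j])%R.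
    move=> i j /eqz eqij; rewrite ![('[_, 'chi_ _])%R]cfdotC !cfdot_indicator //.
    by rewrite /classSum !big_set1 eqij.
  by apply=> //; rewrite (superClass_eq Gz zy).
rewrite !cfun_indicatorE // set11 inE.
by case: eqP => // _ /esym/eqP; rewrite oner_eq0.
Qed.

Lemma superCenter_sub : superCenter S \subset G.
Proof. by apply/subsetP=> z; rewrite inE => /andP[]. Qed.

Lemma superCenter_class x z : x \in G -> z \in superCenter S ->
  superClass S x = superClass S z -> x = z.
Proof.
move=> Gx Zz eqxz; have := mem_superClass Gx.
by rewrite eqxz superCenter_class1 // => /set1P.
Qed.

Lemma superCenter_group : group_set (superCenter S).
Proof.
apply/group_setP; split=> [|y z /superCenterP[Gy yP] /superCenterP[Gz zP]].
  by apply/superCenterP; split=> // i j _; rewrite !abelian_irr1.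
apply/superCenterP; split=> [|i j eqij]; first exact: groupM.
by rewrite !(lin_charM (irr_lin _)) // (yP i j eqij) (zP i j eqij).
Qed.

(** A translation by z multiplies the separating sum of a part by the common
    value at z of the characters in that part. *)
Lemma superClassM x y z : x \in G -> y \in G -> z \in superCenter S ->
  superClass S x = superClass S y -> superClass S (x * z) = superClass S (y * z).
Proof.
move=> Gx Gy /superCenterP[Gz zP] /(eq_superClassP Gx Gy) eqxy.
apply/eq_superClassP=> [||X SX]; rewrite ?groupM //.
have [i Xi] := charPart_neq0 SX.
have sumM t : t \in G -> (charPartSum X (t * z)%g = charPartSum X t * 'chi_i z)%R.
  move=> Gt; rewrite !sum_cfunE mulr_suml; apply: eq_bigr => j Xj.
  rewrite (lin_charM (irr_lin _)) //; congr (_ * _)%R; apply: zP.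
  by rewrite (charPart_def SX Xi) (charPart_def SX Xj).
by rewrite !sumM ?eqxy.
Qed.

Lemma charPartM i j i' j' mu : superFun mu ->
    ('chi_i' = 'chi_i * mu)%R -> ('chi_j' = 'chi_j * mu)%R ->
  charPart i = charPart j -> charPart i' = charPart j'.
Proof.
move=> Smu chi_i' chi_j' /eq_charPartP eqij; apply/eq_charPartP=> A SA.
have [a Aa] := superClass_neq0 SA; have sAG := subsetP (superClass_sub SA).
have sumM h h' : ('chi_h' = 'chi_h * mu)%R ->
    (classSum A ('chi_h') = classSum A ('chi_h) * mu a)%R.
  move=> ->; rewrite mulr_suml; apply: eq_bigr => b Ab; rewrite cfunE.
  congr (_ * _)%R; apply: Smu; rewrite ?sAG //.
  by rewrite (superClass_def SA Aa) (superClass_def SA Ab).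
by rewrite (sumM i i') // (sumM j j') // eqij.
Qed.

Lemma superFun_charPart i : superFun ('chi_i)%R -> charPart i = [set i].
Proof.
move=> /superFunP Si; apply/eqP; rewrite eqEsubset sub1set mem_charPart andbT.
apply/subsetP=> j ij; rewrite inE.
have := Si i j; rewrite (charPart_def (charPart_in i) ij) !cfdot_irr eqxx eq_sym.
by move/(_ erefl); case: eqP => // _ /eqP; rewrite oner_eq0.
Qed.

Lemma superComm_gen x y : x \in G -> y \in G -> superClass S x = superClass S y ->
  x^-1 * y \in superComm S.
Proof.
by move=> Gx Gy eqxy; apply/mem_gen/imset2_f; rewrite ?eqxy ?mem_superClass.
Qed.

Lemma superComm_sub_gen (H : {group gT}) :
    {in G &, forall x y, superClass S x = superClass S y -> x^-1 * y \in H} ->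
  superComm S \subset H.
Proof.
move=> sH; rewrite gen_subG; apply/subsetP=> _ /imset2P[x y Gx xy ->].
apply: sH => //; last by rewrite (superClass_eq Gx xy).
by apply: subsetP xy; rewrite superClass_sub ?superClass_in.
Qed.

Lemma superComm_sub : superComm S \subset G.
Proof. by apply: superComm_sub_gen => x y Gx Gy _; rewrite groupM ?groupV. Qed.

(** The linear characters constant on the superclasses are the dual of G / [G, S];
    they play for the parts the role that Z(S) plays for the superclasses. *)
Lemma superFun_irrP i : superFun ('chi_i)%R <-> superComm S \subset cfker ('chi_i)%R.
Proof.
have kerE x : x \in G -> (x \in cfker ('chi_i)%R) = ('chi_i x == 1)%R.
  by move=> Gx; rewrite cfkerEirr inE lin_char1 ?irr_lin.
split=> [Si | sCK x y Gx Gy eqxy].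
  apply: superComm_sub_gen => x y Gx Gy eqxy.
  rewrite kerE ?groupM ?groupV // (lin_charM (irr_lin i)) ?groupV //.
  by rewrite (lin_charV (irr_lin i)) // (Si x y) // mulVf // lin_char_neq0 ?irr_lin.
have /(subsetP sCK) := superComm_gen Gx Gy eqxy.
rewrite kerE ?groupM ?groupV // => /eqP chi1.
by rewrite -[y](mulKVg x) (lin_charM (irr_lin i)) ?groupM ?groupV // chi1 mulr1.
Qed.

(** [G, S] is the intersection of the kernels of the characters constant on the
    superclasses, and each such kernel is a union of superclasses. *)
Lemma superComm_closed x y : x \in superComm S -> y \in G ->
  superClass S x = superClass S y -> y \in superComm S.
Proof.
move=> Cx Gy eqxy; have Gx := subsetP superComm_sub x Cx.
have nCG : superComm S <| G by rewrite -sub_abelian_normal ?superComm_sub.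
rewrite -[superComm S](cap_cfker_normal nCG); apply/bigcapP=> i sCK.
rewrite cfkerEirr inE lin_char1 ?irr_lin //.
have /superFun_irrP Si := sCK.
have -> : ('chi_i y = 'chi_i x)%R by apply/esym/Si.
by have := subsetP sCK x Cx; rewrite cfkerEirr inE lin_char1 ?irr_lin.
Qed.

End Duality.

(** * The coset dichotomy in an elementary abelian group of order p^2 *)
Section Dichotomy.

Variables (p : nat) (gT : finGroupType) (G W : {group gT}).
Hypotheses (p_prime : prime p) (abelG : p.-abelem G) (cardG : #|G| = (p ^ 2)%N).
Hypotheses (sWG : W \subset G) (cardW : #|W| = p).

Let cGG : abelian G := abelem_abelian abelG.

Lemma abelem_expp x : x \in G -> x ^+ p = 1.
Proof. by move=> Gx; apply: (abelemP p_prime abelG).2. Qed.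

Lemma abelem_cycle x : x \in G -> x != 1 -> #|<[x]>| = p.
Proof. by move=> Gx nt_x; apply: (abelem_order_p abelG). Qed.

Lemma coset_decomposition g y : g \in G -> g \notin W -> y \in G ->
  exists m, exists2 w, w \in W & y = g ^+ m * w.
Proof.
move=> Gg W'g Gy; have ntg : g != 1 by apply: contraNneq W'g => ->.
have og := abelem_cycle Gg ntg.
have tiW : <[g]> :&: W = 1 by rewrite prime_TIg ?og // cycle_subG.
have defG : <[g]> * W = G.
  apply/eqP; rewrite eqEcard mul_subG ?cycle_subG //= TI_cardMg // og cardW.
  by rewrite cardG mulnn.
have: y \in <[g]> * W by rewrite defG.
by case/mulsgP=> _ w /cycleP[m ->] Ww ->; exists m; exists w.
Qed.

(** The classes are the fibres of an arbitrary map, so that the result applies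
    both to the superclasses and to the parts of the dual group. *)
Variables (T : eqType) (cl : gT -> T).
Hypothesis clW : forall x w, x \in G -> w \in W -> cl x = cl w -> x = w.
Hypothesis clM : forall x y w, x \in G -> y \in G -> w \in W ->
  cl x = cl y -> cl (x * w) = cl (y * w).
Hypothesis clX : forall k x y, coprime k #|G| -> x \in G -> y \in G ->
  cl x = cl y -> cl (x ^+ k) = cl (y ^+ k).

Let coGE k : coprime k #|G| = ~~ (p %| k).
Proof. by rewrite cardG coprime_pexpr // coprime_sym prime_coprime. Qed.

Let Wp w k : w \in W -> ~~ (p %| k) -> w ^+ k = 1 -> w = 1.
Proof.
move=> Ww nk wk; have cok : coprime #|W| k by rewrite cardW prime_coprime.
by apply: (can_in_inj (expgK cok)); rewrite ?group1 // wk expg1n.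
Qed.

Lemma power_dvd g k : g \in G -> p %| k -> g ^+ k = 1.
Proof. by move=> Gg /dvdnP[q ->]; rewrite mulnC expgM abelem_expp // expg1n. Qed.

(** If the class of x0 is not reduced to x0, it contains some x0^m w with w in W,
    and m - 1 is invertible modulo p since that class meets x0 W only in x0.
    Translating x0 by the (m-1)-th root u of w gives an element g with g ~ g^m.
    For z = g^n v ~ g with v in W, comparing z^m with g^(mn) v, both in the class
    of g, yields g v^(m-1) ~ g, hence v = 1. *)
Lemma free_class_generator x0 :
    x0 \in G -> x0 \notin W ->
    (forall w, w \in W -> cl (x0 * w) = cl x0 -> w = 1) ->
  exists g, [/\ g \in G, g \notin W
              & forall y, y \in G -> cl y = cl g -> y \in <[g]>].
Proof.
move=> Gx0 W'x0 free0.
have [/existsP[y /and3P[Gy /eqP eqy neqy]] | none] :=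
    boolP [exists y, [&& y \in G, cl y == cl x0 & y != x0]]; last first.
  exists x0; split=> // y Gy eqy; have [-> | neqy] := eqVneq y x0.
    exact: cycle_id.
  by case/existsP: none; exists y; rewrite Gy eqy eqxx.
have [m [w Ww defy]] := coset_decomposition Gx0 W'x0 Gy.
have notinW x : x \notin W -> x \in G -> forall z, z \in G -> cl z = cl x -> z \notin W.
  move=> W'x Gx z Gz eqzx; apply: contra W'x => Wz.
  by rewrite (clW Gx Wz).
have nm : ~~ (p %| m).
  apply: contraL (Ww) => pm; have := notinW _ W'x0 Gx0 _ Gy eqy.
  by rewrite defy power_dvd // mul1g.
have m_gt0 : 0 < m by case: m nm {defy}; rewrite ?dvdn0.
have nm1 : ~~ (p %| m.-1).
  apply: contra neqy => pm1; apply/eqP.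
  have eqy0 : y = x0 * w by rewrite defy -(prednK m_gt0) expgS power_dvd // mulg1.
  by rewrite eqy0 (free0 w) ?mulg1 // -eqy0.
have [u Wu defw] : exists2 u, u \in W & u ^+ m.-1 = w.
  exists (w ^+ expg_invn W m.-1); first exact: groupX.
  by rewrite -expgM mulnC expgM expgK // cardW prime_coprime.
have sW := subsetP sWG; have Gu := sW u Wu; have Gw := sW w Ww.
pose g := x0 * u; have Gg : g \in G by rewrite groupM.
have W'g : g \notin W by rewrite groupMr.
have eqgm : cl (g ^+ m) = cl g.
  rewrite expgMn; last exact: (centsP cGG).
  rewrite -(prednK m_gt0) (expgSr u) defw (prednK m_gt0) mulgA -defy.
  exact: clM.
(* The class of g inherits from that of x0 that it meets g W only in g. *)
have freeg v : v \in W -> cl (g * v) = cl g -> v = 1.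
  move=> Wv eqv; apply: free0 => //.
  have Gv := sW v Wv.
  have := clM (groupM Gg Gv) Gg (groupVr Wu) eqv.
  rewrite mulgK -mulgA -[v * _](centsP cGG) ?groupV // mulgA mulgK.
  by [].
(* Only these properties of g matter below. *)
clearbody g; exists g; split=> // z Gz eqzg.
have [n [v Wv defz]] := coset_decomposition Gg W'g Gz.
have Gv := sW v Wv.
have nn : ~~ (p %| n).
  apply: contraL (Wv) => pn; have := notinW _ W'g Gg _ Gz eqzg.
  by rewrite defz power_dvd // mul1g.
suffices v1 : v = 1 by rewrite defz v1 mulg1 mem_cycle.
apply: (Wp Wv nm1); apply: freeg; first exact: groupX.
pose t := g ^+ (m * n) * v.
have Gt : t \in G by rewrite groupM ?groupX.
have eqtg : cl t = cl g.
  rewrite -eqzg defz /t expgM; apply: clM; rewrite ?groupX //.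
  by apply: clX; rewrite ?groupX ?coGE.
rewrite -(clM Gt Gg (groupX _ Wv) eqtg) /t -mulgA -expgS (prednK m_gt0).
have := clX (_ : coprime m #|G|) Gz Gg eqzg.
rewrite coGE nm eqgm => /(_ isT) <-; rewrite defz expgMn; last first.
  by apply: (centsP cGG); rewrite ?groupX.
by rewrite -expgM (mulnC n).
Qed.

(** As W has prime order, a class that contains x0 and some x0 w with w != 1 in W
    contains the whole coset x0 W.  So a class that is not a union of cosets is
    of the kind considered in [free_class_generator]; the conclusion on the class
    of g extends to all classes, every element being g^j z with z in W. *)
Theorem coset_dichotomy :
    (forall x w, x \in G -> x \notin W -> w \in W -> cl (x * w) = cl x)
  \/ exists g, [/\ g \in G, g \notin W
      & {in G &, forall x y, cl x = cl y -> x^-1 * y \in <[g]>}].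
Proof.
have [/existsP[x0 /existsP[w0]] | none] := boolP [exists x0, exists w0,
    [&& x0 \in G, x0 \notin W, w0 \in W & cl (x0 * w0) != cl x0]]; last first.
  left=> x w Gx W'x Ww; apply/eqP; apply: contraNT none => neq.
  by apply/existsP; exists x; apply/existsP; exists w; rewrite Gx W'x Ww.
case/and4P=> Gx0 W'x0 Ww0 neq0; right; have sW := subsetP sWG.
have [w Ww eqw | g [Gg W'g clg]] := free_class_generator Gx0 W'x0.
  apply: contraNeq neq0 => ntw.
  have defW : <[w]> = W.
    apply/eqP; rewrite eqEcard cycle_subG Ww cardW.
    by rewrite abelem_cycle ?leqnn ?sW.
  have /cycleP[n ->] : w0 \in <[w]> by rewrite defW.
  elim: n => [|n IHn]; first by rewrite mulg1.
  rewrite expgS mulgA -(eqP IHn); apply/eqP; apply: clM; rewrite ?groupX //.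
  by rewrite groupM // sW.
exists g; split=> // x y Gx Gy eqxy.
have [j [z Wz defx]] := coset_decomposition Gg W'g Gx; have Gz := sW z Wz.
have eqj : cl (y * z^-1) = cl (g ^+ j).
  rewrite -[g ^+ j](mulgK z) -defx; apply/esym/clM => //; exact: groupVr.
have Gyz : y * z^-1 \in G by rewrite groupM ?groupV.
have [pj | nj] := boolP (p %| j).
  have eqy : y * z^-1 = 1 by apply: clW; rewrite // eqj power_dvd.
  have -> : y = x by rewrite -[y](mulgKV z) eqy defx power_dvd.
  by rewrite mulVg group1.
have coj : coprime #|G| j by rewrite coprime_sym coGE.
have nk : ~~ (p %| expg_invn G j).
  apply: contra W'g => pk; rewrite -(expgK coj Gg) power_dvd ?groupX //.
have yzg : y * z^-1 \in <[g]>.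
  rewrite -(expgK coj Gyz) -expgM mulnC expgM groupX // clg ?groupX //.
  by rewrite -[in RHS](expgK coj Gg); apply: clX; rewrite ?coGE ?groupX.
rewrite defx invMg -[z^-1 * _](centsP cGG) ?groupV ?groupX //.
rewrite -mulgA [_ * y](centsP cGG) ?groupV // groupM // groupV mem_cycle //.
Qed.

End Dichotomy.

(** * Automorphisms from changes of basis *)
Section BasisChange.

Variables (p : nat) (gT : finGroupType) (G : {group gT}).
Hypotheses (p_prime : prime p) (abelG : p.-abelem G) (cardG : #|G| = (p ^ 2)%N).

Lemma cycle_dprod x d : x \in G -> d \in G -> x != 1 -> d \notin <[x]> ->
  <[x]> \x <[d]> = G.
Proof.
move=> Gx Gd ntx x'd; have ntd : d != 1 by apply: contraNneq x'd => ->.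
have tixd : <[x]> :&: <[d]> = 1.
  by rewrite setIC prime_TIg ?(abelem_cycle abelG) // cycle_subG.
have cxd : <[d]> \subset 'C(<[x]>).
  by rewrite (sub_abelian_cent2 (abelem_abelian abelG)) ?cycle_subG.
rewrite dprodE //; apply/eqP; rewrite eqEcard mul_subG ?cycle_subG //=.
by rewrite TI_cardMg // !(abelem_cycle abelG) // cardG mulnn.
Qed.

Lemma basis_automorphism x y d :
    x \in G -> y \in G -> d \in G -> x != 1 -> y != 1 ->
    d \notin <[x]> -> d \notin <[y]> ->
  exists2 a, a \in Aut G & forall i j, a (x ^+ i * d ^+ j) = y ^+ i * d ^+ j.
Proof.
move=> Gx Gy Gd ntx nty x'd y'd.
have defGx := cycle_dprod Gx Gd ntx x'd.
have /dprodP[_ defGy cyd _] := cycle_dprod Gy Gd nty y'd.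
have dvd_yx : #[y] %| #[x] by rewrite !orderE !(abelem_cycle abelG).
pose fx := [morphism of eltm dvd_yx]; pose fd := idm <[d]>.
have cfxd : fd @* <[d]> \subset 'C(fx @* <[x]>).
  by rewrite im_eltm im_idm.
pose f := [morphism of dprodm defGx cfxd].
have imf : f @* G = G by rewrite im_dprodm im_eltm im_idm.
have injf : 'injm f by rewrite -card_im_injm imf.
exists (aut injf imf) => [|i j]; first exact: Aut_aut.
rewrite autE ?groupM ?groupX //= dprodmE ?mem_cycle //=.
by rewrite eltmE.
Qed.

(** The automorphisms preserving every superclass form the largest possible
    group; changing x into y in the basis (x, d) produces enough of them. *)
Lemma comesFromAutomorphisms_basis (S : superTheory G) :
    {in G &, forall x y, superClass S x = superClass S y -> x != y ->
     exists d, [/\ d \in G, d \notin <[x]>, d \notin <[y]>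
       & forall i j, superClass S (x ^+ i * d ^+ j) = superClass S (y ^+ i * d ^+ j)]} ->
  comesFromAutomorphisms S.
Proof.
move=> basisP; have clP := superClasses_partition S.
pose A := [set a in Aut G | [forall x in G, superClass S (a x) == superClass S x]].
have actG a x : a \in Aut G -> x \in G -> a x \in G.
  by move=> Aa Gx; rewrite Aut_closed.
have AP a x : a \in A -> x \in G -> superClass S (a x) = superClass S x.
  by rewrite inE => /andP[_ /forall_inP clA] Gx; apply/eqP/clA.
have gA : group_set A.
  apply/group_setP; split=> [|a b Aa Ab]; rewrite inE.
    by rewrite group1; apply/forall_inP=> x _; rewrite perm1.
  have [AutA AutB] : a \in Aut G /\ b \in Aut G.
    by move: Aa Ab; rewrite !inE => /andP[-> _] /andP[-> _].
  rewrite groupM //; apply/forall_inP=> x Gx.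
  by rewrite permM AP ?actG // AP.
have orbA x : x \in G -> orbit 'P (Group gA) x = superClass S x.
  move=> Gx; apply/setP=> y; apply/orbitP/idP=> [[a Aa <-] | xy].
    by rewrite /= /aperm -(AP a x Aa Gx) mem_superClass // actG //;
       move: Aa; rewrite inE => /andP[].
  have Gy : y \in G by apply: subsetP xy; apply: superClass_sub (superClass_in S Gx).
  have eqxy := esym (superClass_eq Gx xy).
  have [<- | neqxy] := eqVneq x y.
    by exists 1; rewrite ?group1 //= /aperm perm1.
  have nt u v : u \in G -> v \in G -> superClass S u = superClass S v ->
      u != v -> u != 1.
    move=> Gu Gv equv; apply: contraNneq => u1; apply/eqP.
    have := mem_superClass S Gv; rewrite -equv u1 superClass_id1.
    by move/set1P.
  have ntx := nt x y Gx Gy eqxy neqxy.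
  have nty : y != 1 by rewrite (nt y x) // eq_sym.
  have [d [Gd x'd y'd clxy]] := basisP x y Gx Gy eqxy neqxy.
  have [a AutA aE] := basis_automorphism Gx Gy Gd ntx nty x'd y'd.
  exists a; last by have := aE 1%N 0%N; rewrite !mulg1.
  rewrite inE AutA; apply/forall_inP=> z.
  have /dprodP[_ <- _ _] := cycle_dprod Gx Gd ntx x'd.
  by case/mulsgP=> _ _ /cycleP[i ->] /cycleP[j ->] ->; rewrite aE clxy.
exists (Group gA); split; first by apply/subsetP=> a; rewrite inE => /andP[].
apply/setP=> B; apply/idP/imsetP=> [SB | [x Gx ->]]; last first.
  by rewrite orbA // superClass_in.
have [x Bx] := superClass_neq0 SB.
have Gx : x \in G by apply: subsetP Bx; apply: superClass_sub SB.
by exists x; rewrite // orbA // (superClass_def SB).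
Qed.

End BasisChange.

(** * The dichotomy in the dual group *)
Section OrderP2.

Variables (p : nat) (gT : finGroupType) (G : {group gT}).
Hypotheses (p_prime : prime p) (abelG : p.-abelem G) (cardG : #|G| = (p ^ 2)%N).

Lemma card_proper_nontrivial (H : {group gT}) :
  H \proper G -> H :!=: 1 -> #|H| = p.
Proof.
move=> prHG ntH; have /(dvdn_pfactor _ 2 p_prime)[e le_e2 oH] : #|H| %| p ^ 2.
  by rewrite -cardG cardSg ?proper_sub.
case: e le_e2 oH => [|[|[]]] // _ oH.
  by rewrite -cardG_gt1 oH in ntH.
by have := proper_card prHG; rewrite oH cardG ltnn.
Qed.

Lemma cfker_lin_neq1 (chi : 'CF(G)) : chi \is a linear_char -> cfker chi != 1.
Proof.
move=> lin_chi; apply/eqP=> ker1.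
have defZ : 'Z(chi)%CF = G.
  apply/eqP; rewrite eqEsubset cfcenter_sub; apply/subsetP=> x Gx.
  by rewrite /cfcenter lin_charW // inE Gx normC_lin_char ?lin_char1 //= eqxx.
have := cfcenter_cyclic chi; rewrite /= defZ ker1.
rewrite -(isog_cyclic (quotient1_isog G)) (abelem_cyclic abelG) cardG.
by rewrite pfactorK.
Qed.

End OrderP2.

Section DualDichotomy.

Variables (p : nat) (gT : finGroupType) (G : {group gT}) (S : superTheory G).
Hypotheses (p_prime : prime p) (abelG : p.-abelem G) (cardG : #|G| = (p ^ 2)%N).
Hypotheses (prC : superComm S \proper G) (ntC : superComm S != 1).

Let cGG : abelian G := abelem_abelian abelG.

Let nCG : superComm S <| G.
Proof. by rewrite -(sub_abelian_normal _ cGG) proper_sub. Qed.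

Lemma superComm_separated x : x \in G -> x \notin superComm S ->
  exists2 mu, superComm S \subset cfker ('chi[G]_mu)%R & ('chi_mu x != 1)%R.
Proof.
move=> Gx; rewrite -{1}[superComm S](cap_cfker_normal nCG) => /bigcapP notK.
have [/existsP[mu /andP[sCK K'x]] | none] := boolP [exists mu,
    (superComm S \subset cfker ('chi[G]_mu)%R) && (x \notin cfker ('chi[G]_mu)%R)].
  by exists mu => //; move: K'x; rewrite cfkerEirr inE lin_char1 ?irr_lin.
case: notK => mu sCK; apply: contraNT none => notKx.
by apply/existsP; exists mu; rewrite sCK.
Qed.

(** The dichotomy for the parts, in the group L of linear characters with W the
    group of characters trivial on [G, S].  In its first alternative, let f be
    the indicator function of a superclass and mu in W with mu(x) != 1.  The
    coefficients of f outside W are invariant under translation by W, so f - f mu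
    is a combination of characters in W and is invariant under translation by
    [G, S]; dividing by 1 - mu(x) gives f(x c) = f(x).  In the second, two
    characters of one part differ by a power of g, so they agree on the kernel
    of g, whose elements are therefore in Z(S). *)
Theorem superComm_cosets_or_center :
    (forall x c, x \in G -> x \notin superComm S -> c \in superComm S ->
       superClass S (x * c) = superClass S x)
  \/ superCenter S != 1.
Proof.
have [L [cF [cF_inj cardL cF_lin cF_onto] [cF1 cFM cFX _ _]]] := lin_char_group G.
pose idx u := cfIirr (cF u).
have idxE u : ('chi_(idx u) = cF u)%R by rewrite cfIirrE ?lin_char_irr.
have idx_onto i : exists u, i = idx u.
  have [u chi_u] := cF_onto _ (irr_lin cGG i); exists u.
  by apply: irr_inj; rewrite idxE.
have idx_inj : injective idx by move=> u v eq_uv; apply: cF_inj; rewrite -!idxE eq_uv.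
have cardL2 : #|[set: L]| = (p ^ 2)%N.
  by rewrite cardsT cardL (derG1P cGG) indexg1.
have abelL : p.-abelem [set: L].
  apply/abelemP=> //; split=> [|u _].
    by apply/centsP=> u _ v _; apply: cF_inj; rewrite !cFM mulrC.
  apply: cF_inj; apply/cfun_inP=> x Gx.
  rewrite cFX cF1 exp_cfunE // cfun1E Gx -lin_charX //.
  by rewrite (abelem_expp p_prime abelG) // lin_char1.
pose W0 := [set u | superComm S \subset cfker (cF u)].
have W0P u : u \in W0 <-> superFun S (cF u).
  by rewrite inE -idxE; split=> /(superFun_irrP _ cGG).
have gW : group_set W0.
  apply/group_setP; split=> [|u v /W0P Su /W0P Sv]; apply/W0P.
    by move=> x y Gx Gy _; rewrite cF1 !cfun1E Gx Gy.
  by move=> x y Gx Gy eqxy; rewrite cFM !cfunE (Su x y) // (Sv x y).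
pose W := Group gW.
have ntW : W :!=: 1.
  have [x Gx C'x] : exists2 x, x \in G & x \notin superComm S.
    by have [_ [x Gx C'x]] := properP prC; exists x.
  have [mu sCK mux] := superComm_separated Gx C'x.
  have [u def_mu] := idx_onto mu.
  apply/trivgPn; exists u; first by rewrite inE -idxE -def_mu.
  apply: contraNneq mux => u1; rewrite def_mu idxE u1 cF1 cfun1E Gx.
  by [].
have prW : W \proper [set: L].
  rewrite properT; apply: contraNneq ntC => WT.
  rewrite -subG1 -(TI_cfker_irr G); apply/bigcapsP=> i _.
  have [u ->] := idx_onto i; rewrite idxE.
  by have: u \in W by [rewrite WT inE]; rewrite inE.
have cardW := card_proper_nontrivial p_prime cardL2 prW ntW.
pose cl u := charPart S (idx u).
have clW u w : u \in [set: L] -> w \in W -> cl u = cl w -> u = w.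
  move=> _ /W0P; rewrite -idxE => /(superFun_charPart cGG) clw eq_uw.
  apply: idx_inj; have := mem_charPart S (idx u).
  by rewrite [charPart _ _]eq_uw [cl w]clw => /set1P.
have clM u v w : u \in [set: L] -> v \in [set: L] -> w \in W ->
    cl u = cl v -> cl (u * w) = cl (v * w).
  by move=> _ _ /W0P Sw; apply: (charPartM cGG Sw); rewrite !idxE cFM.
have clX k u v : coprime k #|[set: L]| -> u \in [set: L] -> v \in [set: L] ->
    cl u = cl v -> cl (u ^+ k) = cl (v ^+ k).
  rewrite cardL2 -cardG => cok _ _.
  by apply: (charPartX cGG cok); rewrite !idxE cFX.
have [clWcoset | [g [_ W'g clg]]] :=
    coset_dichotomy p_prime abelL cardL2 (proper_sub prW) cardW clW clM clX.
  left=> x c Gx C'x Cc; have Gc := subsetP (proper_sub prC) c Cc.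
  have [mu sCK mux] := superComm_separated Gx C'x.
  have [w def_mu] := idx_onto mu.
  have Ww : w \in W by rewrite inE -idxE -def_mu.
  rewrite def_mu idxE in mux.
  pose f := ('1_(superClass S x) : 'CF(G))%R.
  have Sf : superFun S f := indicator_superFun cGG (superClass_in S Gx).
  pose h := (f - f * cF w)%R.
  have coef_h u : u \notin W -> ('[h, cF u] = 0)%R.
    move=> W'u; have W'v : u * w^-1 \notin W by rewrite groupMr ?groupV.
    have def_u : cF u = (cF (u * w^-1)%g * cF w)%R by rewrite -cFM mulgKV.
    have fw : ('[f * cF w, cF u] = '[f, cF (u * w^-1)%g])%R.
      rewrite !cfdotE; congr (_ * _)%R; apply: eq_bigr => y Gy.
      rewrite def_u !cfunE rmorphM mulrACA -normCK normC_lin_char //.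
      by rewrite expr1n mulr1.
    rewrite cfdotBl fw -!idxE ((superFunP S cGG f).1 Sf _ (idx (u * w^-1))) ?subrr //.
    rewrite -[u in LHS](mulgKV w); apply: (clWcoset _ _ _ W'v Ww).
    by rewrite inE.
  have hxc : (h (x * c)%g = h x)%R.
    rewrite (cfun_sum_cfdot h) !sum_cfunE; apply: eq_bigr => i _; rewrite !cfunE.
    have [u ->] := idx_onto i; rewrite idxE.
    have [Wu | W'u] := boolP (u \in W); last by rewrite coef_h // !mul0r.
    rewrite lin_charM //; congr (_ * _)%R.
    suffices -> : cF u c = 1%R by rewrite mulr1.
    have := Wu; rewrite inE => /subsetP/(_ c Cc).
    by rewrite -idxE cfkerEirr inE lin_char1 ?irr_lin // => /eqP.
  have wxc : cF w (x * c) = cF w x.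
    have := Ww; rewrite inE => /subsetP/(_ c Cc).
    rewrite -idxE cfkerEirr inE lin_char1 ?irr_lin // => /eqP wc.
    by rewrite lin_charM ?irr_lin // wc mulr1.
  have hE y : cF w y = cF w x -> (h y = f y * (1 - cF w x))%R.
    by move=> wy; rewrite !cfunE wy mulrBr mulr1.
  (* Divide by 1 - mu(x), nonzero by the choice of mu. *)
  move: hxc; rewrite !hE // => /(mulIf _) fxc.
  have: f (x * c) = f x by apply: fxc; rewrite subr_eq0 eq_sym.
  have sxG := superClass_sub (superClass_in S Gx).
  rewrite !(cfun_indicatorE cGG _ sxG) mem_superClass //.
  case: (boolP (_ \in _)) => [xc _ | _ /esym/eqP]; last by rewrite oner_eq0.
  exact: superClass_eq xc.
right; have [z kerz ntz] := trivgPn _ (cfker_lin_neq1 p_prime abelG cardG (cF_lin g)).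
have Gz : z \in G by apply: subsetP kerz; apply: cfker_sub.
have gz1 : cF g z = 1%R.
  by move: kerz; rewrite /= -idxE cfkerEirr inE lin_char1 ?irr_lin // => /eqP.
apply: contraNneq ntz => Z1; rewrite -in_set1 -[[set 1]]Z1.
apply/(superCenterP S cGG); split=> // i j eqij.
have [u def_i] := idx_onto i; have [v def_j] := idx_onto j.
have: u^-1 * v \in <[g]> by apply: clg; rewrite ?inE // /cl -def_i -def_j.
case/cycleP=> n def_n; have {}def_n : v = u * g ^+ n by rewrite -def_n mulKVg.
rewrite def_i def_j def_n; rewrite !idxE cFM cFX cfunE exp_cfunE //.
by rewrite gz1 expr1n mulr1.
Qed.

End DualDichotomy.

(** * Star products and direct products *)
Section Products.

Variables (gT : finGroupType) (G : {group gT}) (S : superTheory G).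
Hypothesis cGG : abelian G.

Definition superClosed (N : {set gT}) : Prop :=
  {in N & G, forall x y, superClass S x = superClass S y -> y \in N}.

Lemma superComm_superClosed : superClosed (superComm S).
Proof. by move=> x y Cx Gy; apply: superComm_closed. Qed.

Lemma superCenter_superClosed : superClosed (superCenter S).
Proof. by move=> z y Zz Gy eqzy; rewrite (superCenter_class Gy Zz). Qed.

Lemma superClosed_class (N A : {set gT}) x : superClosed N ->
  A \in superClasses S -> x \in A -> x \in N -> A \subset N.
Proof.
move=> clN SA Ax Nx; have sAG := subsetP (superClass_sub SA).
apply/subsetP=> y Ay; apply: (clN x) => //; first exact: sAG.
by rewrite !(superClass_def SA).
Qed.

Lemma superClosed_superNormal (N : {group gT}) :
  N \subset G -> superClosed N -> superNormal S N.
Proof.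
move=> sNG clN; split; first exact: groupP.
exists (subSuperClasses S N); split.
  by apply/subsetP=> A; rewrite inE => /andP[].
apply/eqP; rewrite eqEsubset; apply/andP; split.
  by apply/bigcupsP=> A; rewrite inE => /andP[].
apply/subsetP=> x Nx; have Gx := subsetP sNG x Nx.
apply/bigcupP; exists (superClass S x); last exact: mem_superClass.
have SA := superClass_in S Gx.
by rewrite inE SA (superClosed_class clN SA (mem_superClass S Gx)).
Qed.

Lemma starProduct_cosets (N : {group gT}) : N \subset G -> superClosed N ->
    (forall x n, x \in G -> x \notin N -> n \in N ->
       superClass S (x * n) = superClass S x) ->
  starProductOver S N.
Proof.
move=> sNG clN cosetN; split; first exact: superClosed_superNormal.
have nNG : G \subset 'N(N) := sub_abelian_norm cGG sNG.
have preA A : A \in superClasses S -> ~~ (A \subset N) ->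
    coset N @*^-1 (A / N) = A.
  move=> SA nsAN; have sAG := superClass_sub SA.
  rewrite quotientK; last exact: subset_trans nNG.
  apply/eqP; rewrite eqEsubset mulG_subr andbT.
  apply/subsetP=> _ /mulsgP[n a Nn Aa ->]; have Ga := subsetP sAG a Aa.
  have N'a : a \notin N.
    by apply: contra nsAN => Na; apply: superClosed_class Aa Na.
  have Gn := subsetP sNG n Nn.
  rewrite (centsP cGG n Gn a Ga) -(superClass_def SA Aa) -(cosetN a n) //.
  by rewrite mem_superClass // groupM.
have quo1 A : A \in superClasses S -> (A / N == [set 1]) = (A \subset N).
  move=> SA; have [x Ax] := superClass_neq0 SA.
  have sAG := subsetP (superClass_sub SA).
  have inQ a : a \in A -> coset N a \in A / N.
    by move=> Aa; apply: mem_morphim; rewrite /= ?(subsetP nNG) ?sAG.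
  apply/eqP/idP=> [quoA | sAN].
    apply/subsetP=> a Aa; apply: coset_idr; first by rewrite (subsetP nNG) ?sAG.
    by apply/set1P; rewrite -quoA inQ.
  apply/eqP; rewrite eqEsubset; apply/andP; split.
    apply/subsetP=> _ /morphimP[a _ Aa ->]; apply/set1P.
    by apply: coset_id; apply: (subsetP sAN).
  by rewrite sub1set -(coset_id (subsetP sAN x Ax)) inQ.
apply/setP=> A; apply/idP/setUP=> [SA | [|]].
- have [sAN | nsAN] := boolP (A \subset N); first by left; rewrite inE SA.
  right; apply/imsetP; exists (A / N); last by rewrite preA.
  by rewrite inE imset_f //= quo1.
- by rewrite inE => /andP[].
case/imsetP=> B; rewrite inE => /andP[/imsetP[D SD ->]].
rewrite quo1 // => nsDN ->.
by rewrite preA.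
Qed.

Lemma superClass_rcoset x z : x \in G -> z \in superCenter S ->
  superClass S (x * z) = superClass S x * [set z].
Proof.
move=> Gx Zz; have Gz := subsetP (superCenter_sub S) z Zz.
have Zz' : z^-1 \in superCenter S by rewrite (groupV (Group (superCenter_group S cGG))).
have sub u : u \in G -> {subset superClass S u <= G}.
  by move=> Gu; apply/subsetP/superClass_sub/superClass_in.
apply/setP=> y; rewrite mem_rcoset; apply/idP/idP=> [xzy | xy].
  have Gxz := groupM Gx Gz; have Gy := sub _ Gxz y xzy.
  have := superClassM cGG Gy Gxz Zz' (superClass_eq Gxz xzy).
  by rewrite mulgK => <-; rewrite mem_superClass // groupM ?groupV.
have Gyz := sub _ Gx _ xy.
have := superClassM cGG Gyz Gx Zz (superClass_eq Gx xy).
rewrite mulgKV => <-; apply: mem_superClass.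
by rewrite -[y](mulgKV z) groupM.
Qed.

Lemma directProduct_center (N : {group gT}) : superClosed N ->
  N \x superCenter S = G -> directProductOver S N (superCenter S).
Proof.
set Z := Group (superCenter_group S cGG) => clN defG.
have [_ defNZ _ _] := dprodP defG.
have sNG : N \subset G by rewrite -defNZ (mulG_subl Z).
have sZG : Z \subset G := superCenter_sub S.
have clZ : superClosed Z.
  by move=> z y Zz Gy eqzy; rewrite (superCenter_class Gy Zz).
have prodE c z : c \in G -> z \in Z ->
    superClass S (c * z) = superClass S c * superClass S z.
  by move=> Gc Zz; rewrite superClass_rcoset // (superCenter_class1 Zz).
split=> //; try exact: superClosed_superNormal.
  exact: (superClosed_superNormal (N := Z)).
have inSub (M : {group gT}) c : M \subset G -> superClosed M -> c \in M ->
    superClass S c \in subSuperClasses S M.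
  move=> sMG clM Mc; have Gc := subsetP sMG c Mc; have SA := superClass_in S Gc.
  by rewrite inE SA (superClosed_class clM SA (mem_superClass S Gc)).
apply/setP=> A; apply/idP/imset2P=> [SA | [B D]].
  have [x Ax] := superClass_neq0 SA.
  have : x \in N * Z by rewrite defNZ (subsetP (superClass_sub SA)).
  case/mulsgP=> c z Nc Zz defx.
  exists (superClass S c) (superClass S z); try exact: inSub.
    exact: (inSub Z).
  by rewrite -prodE ?(subsetP sNG) // -defx (superClass_def SA).
rewrite !inE => /andP[SB sBN] /andP[SD sDZ] ->.
have [b Bb] := superClass_neq0 SB; have [d Dd] := superClass_neq0 SD.
have Gb := subsetP (superClass_sub SB) b Bb.
have Zd : d \in Z by apply: (subsetP sDZ).
rewrite -(superClass_def SB Bb) -(superClass_def SD Dd) -prodE //.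
by rewrite superClass_in // groupM // (subsetP sZG).
Qed.

End Products.

(** * The case distinction on [Z(S)] *)
Section Main.

Variables (p : nat) (gT : finGroupType) (G : {group gT}) (S : superTheory G).
Hypotheses (p_prime : prime p) (abelG : p.-abelem G) (cardG : #|G| = (p ^ 2)%N).

Let cGG : abelian G := abelem_abelian abelG.

Lemma notin_cycle (H : {group gT}) d x :
  d \in H -> d != 1 -> x \in G -> x \notin H -> d \notin <[x]>.
Proof.
move=> Hd ntd Gx; apply: contra => xd.
have ntx : x != 1 by apply: contraNneq ntd => x1; rewrite x1 cycle1 inE in xd.
have Gd : d \in G by apply: subsetP xd; rewrite cycle_subG.
have: <[d]> == <[x]>.
  by rewrite eqEcard cycle_subG xd !(abelem_cycle abelG) ?leqnn.
move/eqP=> eqdx; have: x \in <[d]> by rewrite eqdx cycle_id.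
by apply/subsetP; rewrite cycle_subG.
Qed.

Lemma power_notin (H : {group gT}) x k :
  x \in G -> x \notin H -> ~~ (p %| k) -> x ^+ k \notin H.
Proof.
move=> Gx H'x nk; apply: contra H'x => Hxk.
have cok : coprime #|G| k by rewrite cardG coprime_pexpl // prime_coprime.
by rewrite -(expgK cok Gx) groupX.
Qed.

Lemma superClass_power k x y : x \in G -> y \in G ->
  superClass S x = superClass S y -> superClass S (x ^+ k) = superClass S (y ^+ k).
Proof.
move=> Gx Gy eqxy; have [pk | nk] := boolP (p %| k).
  by rewrite !(power_dvd p_prime abelG).
by apply: superClassX => //; rewrite cardG coprime_pexpr // coprime_sym prime_coprime.
Qed.

(** A nontrivial d in Z(S) completes both x and y to a basis, since neither lies in
    Z(S) when y ~ x is different from x. *)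
Lemma center_comesFromAutomorphisms :
  superCenter S != 1 -> comesFromAutomorphisms S.
Proof.
set Z := Group (superCenter_group S cGG) => ntZ.
have [d Zd ntd] := trivgPn Z ntZ; have sZG : Z \subset G := superCenter_sub S.
apply: (comesFromAutomorphisms_basis p_prime abelG cardG) => x y Gx Gy eqxy neqxy.
have Z'x : x \notin Z.
  apply: contra neqxy => Zx; apply/eqP/esym.
  exact: superCenter_class Gy Zx (esym eqxy).
have Z'y : y \notin Z.
  by apply: contra neqxy => Zy; apply/eqP; apply: superCenter_class Gx Zy eqxy.
exists d; split=> [|||i j]; try exact: (notin_cycle Zd); first exact: (subsetP sZG).
have Zdj : d ^+ j \in Z by rewrite groupX.
by apply: superClassM; rewrite ?groupX //; apply: superClass_power.
Qed.

(** For x in N any d outside N will do, and for x outside N any nontrivial d in N: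
    a product x^i d^j whose factor outside N is not 1 has the superclass of that
    factor. *)
Lemma star_comesFromAutomorphisms (N : {group gT}) :
    N \proper G -> N :!=: 1 -> superClosed S N ->
    (forall x n, x \in G -> x \notin N -> n \in N ->
       superClass S (x * n) = superClass S x) ->
  comesFromAutomorphisms S.
Proof.
move=> prN ntN clN cosetN; have sNG := subsetP (proper_sub prN).
apply: (comesFromAutomorphisms_basis p_prime abelG cardG) => x y Gx Gy eqxy neqxy.
have [Nx | N'x] := boolP (x \in N).
  have [_ [d Gd N'd]] := properP prN; have Ny := clN x y Nx Gy eqxy.
  have nd z : z \in N -> d \notin <[z]>.
    by move=> Nz; apply: contra N'd; apply/subsetP; rewrite cycle_subG.
  exists d; split; rewrite ?nd // => i j.
  have [pj | nj] := boolP (p %| j).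
    by rewrite !(power_dvd p_prime abelG Gd pj) !mulg1; apply: superClass_power.
  have cl z : z \in N -> superClass S (z ^+ i * d ^+ j) = superClass S (d ^+ j).
    move=> Nz; have Gz := sNG z Nz.
    rewrite (centsP cGG (z ^+ i) _ (d ^+ j)) ?groupX //.
    by rewrite cosetN ?power_notin ?groupX.
  by rewrite !cl.
have N'y : y \notin N by apply: contra N'x => Ny; apply: clN (esym eqxy).
have [d Nd ntd] := trivgPn N ntN.
exists d; split=> [|||i j]; try exact: (notin_cycle Nd); first exact: sNG.
have [pi | ni] := boolP (p %| i).
  by rewrite !(power_dvd p_prime abelG _ pi).
by rewrite !cosetN ?power_notin ?groupX //; apply: superClass_power.
Qed.

Lemma superComm_neq1 : superCenter S != G -> superComm S != 1.
Proof.
apply: contra => /eqP C1; rewrite eqEsubset superCenter_sub; apply/subsetP=> x Gx.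
rewrite inE Gx; apply/cards1P; exists x; apply/eqP.
rewrite eqEsubset sub1set mem_superClass // andbT; apply/subsetP=> y xy.
have Gy : y \in G by apply: subsetP xy; apply: superClass_sub (superClass_in S Gx).
have := superComm_gen Gx Gy (esym (superClass_eq Gx xy)).
by rewrite C1 => /set1gP/eqP; rewrite -eq_mulVg1 => /eqP <-; rewrite inE.
Qed.

Lemma center_star_or_direct : superCenter S \proper G -> superCenter S != 1 ->
  starProductOver S (superCenter S)
  \/ directProductOver S (superComm S) (superCenter S).
Proof.
pose Z := Group (superCenter_group S cGG) => prZ ntZ.
have cardZ := card_proper_nontrivial p_prime cardG (H := Z) prZ ntZ.
have sZG : Z \subset G := superCenter_sub S.
have [cosetZ | [g [Gg Z'g clg]]] := coset_dichotomy p_prime abelG cardG sZG cardZ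
    (superCenter_class (S := S)) (superClassM cGG (S := S))
    (superClassX cGG (S := S)).
  by left; apply: (starProduct_cosets cGG (N := Z)) => //; apply: superCenter_superClosed.
right; apply: directProduct_center => //; first exact: (superComm_superClosed cGG).
have ntg : g != 1 by apply: contraNneq Z'g => ->; apply: group1.
have cardg := abelem_cycle abelG Gg ntg.
have defC : superComm S = <[g]>.
  apply/eqP; rewrite eqEcard superComm_sub_gen //= cardg.
  have neqZ : superCenter S != G by apply: contraTneq prZ => ->; rewrite properxx.
  rewrite (card_proper_nontrivial p_prime cardG) ?superComm_neq1 //.
  apply: sub_proper_trans (superComm_sub_gen clg) _.
  rewrite properEcard cycle_subG Gg cardg cardG -[X in X < _]expn1.
  by rewrite ltn_exp2l ?prime_gt1.
have tiCZ : <[g]> :&: Z = 1 by rewrite prime_TIg ?cardg // cycle_subG.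
change (superComm S \x Z = G); rewrite defC.
have cardgZ : #|<[g]> * Z| = #|G| by rewrite TI_cardMg // cardg cardZ cardG mulnn.
have cgZ : Z \subset 'C(<[g]>) by rewrite (sub_abelian_cent2 cGG) ?cycle_subG.
rewrite dprodE //; apply/eqP; rewrite eqEcard cardgZ leqnn andbT.
by rewrite mul_subG ?cycle_subG.
Qed.

End Main.

Theorem theorem4p2 (p : nat) (gT : finGroupType) (G : {group gT})
    (S : superTheory G) (p_prime : prime p) (p_odd : odd p)
    (abelG : abelian G) (cardG : #|G| = (p ^ 2)%N) (expG : exponent G = p)
    (hS : superComm S \proper G \/ [1 gT] \proper superCenter S) :
  [\/ starProductOver S (superComm S),
      starProductOver S (superCenter S)
    | directProductOver S (superComm S) (superCenter S)]
  /\ comesFromAutomorphisms S.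
Proof.
have abelpG : p.-abelem G by rewrite abelemE // abelG expG dvdnn.
pose Z := Group (superCenter_group S abelG).
have clZ := superCenter_superClosed (S := S).
have [ZG | neqZG] := eqVneq (superCenter S) G.
  have ntZ : superCenter S != 1.
    by rewrite ZG -cardG_gt1 cardG -(exp1n 2) ltn_exp2r ?prime_gt1.
  split; last exact: center_comesFromAutomorphisms p_prime abelpG cardG ntZ.
  apply: Or32; apply: (starProduct_cosets abelG (N := Z) (superCenter_sub S) clZ).
  by move=> x n Gx; rewrite /= ZG Gx.
have [Z1 | ntZ] := eqVneq (superCenter S) 1; last first.
  split; last exact: center_comesFromAutomorphisms p_prime abelpG cardG ntZ.
  have prZ : superCenter S \proper G by rewrite properEneq neqZG superCenter_sub.
  have [] := center_star_or_direct p_prime abelpG cardG prZ ntZ.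
    by apply: Or32.
  by apply: Or33.
have prC : superComm S \proper G by case: hS => //; rewrite Z1 properxx.
have ntC := superComm_neq1 neqZG.
have clC := superComm_superClosed (S := S) abelG.
have [cosetC | ] := superComm_cosets_or_center p_prime abelpG cardG prC ntC;
  last by rewrite Z1 eqxx.
split; last exact: (star_comesFromAutomorphisms p_prime abelpG cardG prC ntC clC).
by apply: Or31; apply: starProduct_cosets => //; apply: proper_sub.
Qed.
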